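(* Let $\boldsymbol{\mu}=(\lambda_1,\lambda_2,\lambda_3,\mu)\in U$, where $U=[0,+\infty)^3\times(-\infty,4]\subset\mathbb{R}^4$. Let $T_{\boldsymbol{\mu}}$ be the largest positive real root of $$X^3-3X^2-(\lambda_1+\lambda_2+\lambda_3)X+\mu=0.$$ When restricted to $\boldsymbol{\mu}$-Markoff maps with real positive image, the sink constant is $$M(\boldsymbol{\mu})=T_{\boldsymbol{\mu}}.$$
   Context: Tree and regions. Let $\mathcal{T}$ be the infinite trivalent tree, properly embedded in the hyperbolic plane, dual to the Farey triangulation, and let $\Omega$ be the set of its complementary regions (closures of connected components of the complement; indexed by $\mathbb{Q}\cup\{\infty\}$). Each vertex is met by exactly three regions. For an edge $e$, write $e\leftrightarrow(X,Y;Z,W)$ if $e=X\cap Y$ and $e\cap Z$, $e\cap W$ are the two endpoints of $e$. Fix a tri-coloring of regions and edges by $\{1,2,3\}$ such that for any edge $e\leftrightarrow(X,Y;Z,W)$, $e$, $Z$ and $W$ have the same color and the colors of $e$, $X$, $Y$ are all different (this is unique up to permutation of colors). Then the three regions at any vertex have different colors. $\Omega_i$ is the set of regions of color $i$. Markoff maps. For $\boldsymbol{\mu}=(\lambda_1,\lambda_2,\lambda_3,\mu)\in\mathbb{C}^4$, a $\boldsymbol{\mu}$-Markoff map is a function $\phi:\Omega\to\mathbb{C}$ such that (i) for any three regions $X_i\in\Omega_i$ ($i=1,2,3$) meeting at a vertex, with $x_i=\phi(X_i)$, one has $x_1^2+x_2^2+x_3^2-x_1x_2x_3+\lambda_1x_1+\lambda_2x_2+\lambda_3x_3=\mu$;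 (ii) for every edge $e\leftrightarrow(X_j,X_k;X_i,X_i')$ of color $i$, $\phi(X_i)+\phi(X_i')=\phi(X_j)\phi(X_k)-\lambda_i$. It has real positive image if $\phi(\Omega)\subset\mathbb{R}_+$. Arrows and sinks. Given $\phi$ and $e\leftrightarrow(X,Y;Z,W)$, the edge $e$ carries an arrow pointing towards $W$ if $|\phi(Z)|\ge|\phi(W)|$ and an arrow pointing towards $Z$ if $|\phi(Z)|\le|\phi(W)|$ (both in case of equality). A vertex is a sink for $\phi$ if all three incident edges carry an arrow pointing towards it. Sink constant. Restricted to Markoff maps with real positive image, $M(\boldsymbol{\mu})$ is the smallest constant $m$ such that for every $\boldsymbol{\mu}$-Markoff map $\phi$ with real positive image and every three regions $X_1,X_2,X_3$ meeting at a sink of $\phi$, $\min\{|\phi(X_1)|,|\phi(X_2)|,|\phi(X_3)|\}\le m$. *)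

(* Defs.v *)
From mathcomp Require Import all_boot all_order all_algebra.
From mathcomp Require Import reals complex.

Set Implicit Arguments.
Unset Strict Implicit.
Unset Printing Implicit Defensive.

Import Order.TTheory GRing.Theory Num.Theory.
Local Open Scope ring_scope.
Local Open Scope complex_scope.

(* The trivalent tree is encoded through the dual Farey triangulation: its
   complementary regions are the vertices Q u {oo} of the triangulation, with
   None standing for oo = 1/0; an edge of the tree is the common boundary X n Y
   of two regions joined by a side of the triangulation; a vertex of the tree
   is a Farey triangle. *)
Definition region := option rat.

Definition rnum (X : region) : int := if X is Some q then numq q else 1.
Definition rden (X : region) : int := if X is Some q then denq q else 0.

Definition adjacent (X Y : region) : bool :=
  `|rnum X * rden Y - rnum Y * rden X| == 1.

Definition vertex (X Y Z : region) : bool :=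
  [&& adjacent X Y, adjacent Y Z & adjacent X Z].

(* e <-> (X, Y; Z, W): the edge e = X n Y has the two endpoints e n Z, e n W. *)
Definition edge (X Y Z W : region) : bool :=
  [&& vertex X Y Z, vertex X Y W & Z != W].

(* [c] colors regions; [ce X Y] is the color of the edge X n Y and is
   meaningful only when X and Y are adjacent.  Applying the condition to
   (X, Y; Z, W) and to (Y, X; Z, W) gives ce X Y = ce Y X on edges. *)
Definition tricoloring (c : region -> 'I_3) (ce : region -> region -> 'I_3) :=
  forall X Y Z W, edge X Y Z W ->
    [/\ ce X Y = c Z, ce X Y = c W
      & [/\ ce X Y <> c X, ce X Y <> c Y & c X <> c Y]].

Section Markoff.
Variables (R : realType) (c : region -> 'I_3) (ce : region -> region -> 'I_3).

(* The colors 1, 2, 3 are the elements 0, 1, 2 of 'I_3. *)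
Definition markoff_map (lam : 'I_3 -> R[i]) (mu : R[i])
    (phi : region -> R[i]) :=
  (forall X : 'I_3 -> region,
     (forall i, c (X i) = i) -> vertex (X 0) (X 1) (X 2) ->
     \sum_i phi (X i) ^+ 2 - \prod_i phi (X i) + \sum_i lam i * phi (X i) = mu)
  /\
  (forall X Y Z W, edge X Y Z W ->
     phi Z + phi W = phi X * phi Y - lam (ce X Y)).

(* In the order of R[i], 0 < z means that z is real and positive. *)
Definition real_positive_image (phi : region -> R[i]) := forall X, 0 < phi X.

(* The edge e <-> (X, Y; Z, W) carries an arrow pointing towards W. *)
Definition arrow (phi : region -> R[i]) (X Y Z W : region) : bool :=
  edge X Y Z W && (`|phi W| <= `|phi Z|).

Definition sink (phi : region -> R[i]) (X Y Z : region) :=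
  [/\ vertex X Y Z,
      exists W, arrow phi Y Z W X,
      exists W, arrow phi X Z W Y
    & exists W, arrow phi X Y W Z].

Definition sink_bound (lam : 'I_3 -> R[i]) (mu : R[i]) (m : R) :=
  forall phi, markoff_map lam mu phi -> real_positive_image phi ->
  forall X Y Z, sink phi X Y Z ->
    Num.min `|phi X| (Num.min `|phi Y| `|phi Z|) <= m%:C.

Definition is_sink_constant (lam : 'I_3 -> R[i]) (mu : R[i]) (M : R) :=
  sink_bound lam mu M /\ forall m, sink_bound lam mu m -> M <= m.

End Markoff.

Definition is_largest_positive_root (R : realType) (p : {poly R}) (T : R) :=
  [/\ 0 < T, root p T & forall x, 0 < x -> root p x -> x <= T].

(* Main.v *)
(* Put f(X) = X^3 - 3X^2 - (l1 + l2 + l3)X + mu.  On U one has f(2) <= 0,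
   so f has a root T >= 2; moreover f > 0 beyond T, and T^2 - 2T >= li.

   At a sink with values x <= y <= z the arrows give 2z + l3 <= xy, so the vertex
   polynomial F does not decrease from (x, y, z) to (x, y, y); if x > T it does
   not decrease from there to (x, x, x) either, so
   mu = F(x, y, z) <= F(x, x, x) = mu - f(x) < mu, a contradiction.

   Conversely F(T, T, T) = mu, so some Markoff map takes the value T at the three
   regions oo, 0, 1.  Its values are computed by a subtractive Euclidean
   algorithm on fractions p/q; since T^2 - 2T >= li the arrows away from the
   initial vertex all point back to it, whence all values are at least T and this
   vertex is a sink. *)
Require Import Defs.
From mathcomp Require Import all_boot all_order all_algebra.
From mathcomp Require Import reals complex.
From mathcomp Require Import zify ring lra.

Set Implicit Arguments.
Unset Strict Implicit.
Unset Printing Implicit Defensive.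

Import Order.TTheory GRing.Theory Num.Theory.
Local Open Scope ring_scope.
Local Open Scope complex_scope.

(** * Unimodular pairs of integer vectors *)

Definition nunimod (a b c d : nat) : Prop :=
  (a * d = b * c + 1 \/ b * c = a * d + 1)%N.

(** Vectors (a, b), (c, d) of determinant 1 or -1 lie strictly on opposite sides of the diagonal
    only if they are the two basis vectors. Otherwise one subtractive Euclidean step applies to both
    at once and lowers the sum of the entries. *)
Lemma nunimod_cases a b c d : nunimod a b c d ->
  [\/ [/\ (0 < a)%N, (0 < c)%N, (0 < b + d)%N & (b <= a)%N /\ (d <= c)%N],
      [/\ (0 < b)%N, (0 < d)%N, (0 < a + c)%N & (a <= b)%N /\ (c <= d)%N],
      [/\ a = 1, b = 0, c = 0 & d = 1]%N
    | [/\ a = 0, b = 1, c = 1 & d = 0]%N].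
Proof.
rewrite /nunimod => H.
have [ba|ab] := leqP b a; have [dc|cd] := leqP d c.
- by apply: Or41; split=> //; nia.
- have [ab|ab] := leqP a b.
    by apply: Or42; split=> //; nia.
  by apply: Or43; split=> //; nia.
- have [ab'|ab'] := leqP c d.
    by apply: Or42; split=> //; nia.
  by apply: Or44; split=> //; nia.
- by apply: Or42; split=> //; nia.
Qed.

(** Outside the basis pair one vector dominates the other coordinatewise, so their difference stays
    in the quadrant. *)
Lemma nunimod_le a b c d : nunimod a b c d ->
  [\/ (c <= a)%N /\ (d <= b)%N, (a <= c)%N /\ (b <= d)%N,
      [/\ a = 1, b = 0, c = 0 & d = 1]%N
    | [/\ a = 0, b = 1, c = 1 & d = 0]%N].
Proof.
rewrite /nunimod => H.
have [ca|ac] := leqP c a; have [db|bd] := leqP d b.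
- exact: Or41.
- have [ca'|ca'] := leqP a c; first by apply: Or42; lia.
  by apply: Or43; split; nia.
- have [ca'|ca'] := leqP b d; first by apply: Or42; lia.
  by apply: Or44; split; nia.
- by apply: Or42; lia.
Qed.

Definition comb (U V : int * int) (p q : nat) : int * int :=
  (U.1 * p%:Z + V.1 * q%:Z, U.2 * p%:Z + V.2 * q%:Z).

Lemma combD U V a b c d :
  comb U V a b + comb U V c d = comb U V (a + c) (b + d).
Proof. by rewrite /comb; congr pair => /=; rewrite !PoszD; ring. Qed.

Lemma comb_10 U V : comb U V 1 0 = U.
Proof. by case: U V => [a b] [c d]; rewrite /comb /=; congr pair; ring. Qed.

Lemma comb_01 U V : comb U V 0 1 = V.
Proof. by case: U V => [a b] [c d]; rewrite /comb /=; congr pair; ring. Qed.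

Lemma comb_right U V p q : (q <= p)%N ->
  comb U (U + V) (p - q) q = comb U V p q.
Proof.
by move=> /subnK <-; rewrite addnK /comb /=; congr pair; rewrite PoszD; ring.
Qed.

Lemma comb_left U V p q : (p <= q)%N ->
  comb (U + V) V p (q - p) = comb U V p q.
Proof.
by move=> /subnK <-; rewrite addnK /comb /=; congr pair; rewrite PoszD; ring.
Qed.

Definition unimod (u v : int * int) : bool := `|u.1 * v.2 - v.1 * u.2| == 1.

Lemma unimodDr u v : unimod u (u + v) = unimod u v.
Proof. by rewrite /unimod /=; congr (`|_| == 1); ring. Qed.

Lemma unimodDl u v : unimod (u + v) v = unimod u v.
Proof. by rewrite /unimod /=; congr (`|_| == 1); ring. Qed.

Lemma unimodC u v : unimod u v = unimod v u.
Proof. by rewrite /unimod distrC. Qed.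

Lemma unimodNl u v : unimod (- u) v = unimod u v.
Proof.
by rewrite /unimod /= -(normrN (u.1 * v.2 - _)); congr (`|_| == 1); ring.
Qed.

(** * Values in one quadrant by the Euclidean algorithm *)

Section Farey.
Variables (R : realFieldType) (L : int * int -> R).

(* The value at [comb U V p q] of the map with values [x], [y], [z] at [U], [V],
   [U - V] that satisfies the edge relations; the first argument is fuel. *)
Fixpoint farey_rec n (U V : int * int) (x y z : R) (p q : nat) : R :=
  if n is n'.+1 then
    if p == 0%N then y else if q == 0%N then x else
    let w := x * y - L (U + V) - z in
    if (q <= p)%N then farey_rec n' U (U + V) x w y (p - q) q
    else farey_rec n' (U + V) V w y x p (q - p)
  else y.

Definition farey U V x y z p q := farey_rec (p + q) U V x y z p q.

(** For positive [p] and [q] a step replaces p + q by the larger of the two, so this much fuel is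
    never exhausted too early. *)
Lemma farey_rec_fuel n U V x y z p q : (p + q <= n)%N ->
  farey_rec n U V x y z p q = farey U V x y z p q.
Proof.
have H m n' : (p + q <= m)%N -> (p + q <= n')%N ->
    farey_rec m U V x y z p q = farey_rec n' U V x y z p q.
  elim: m n' U V x y z p q => [|m IH] [|n'] U' V' x' y' z' p' q' //=.
  - by rewrite leqn0 addn_eq0 => /andP[/eqP-> _].
  - by move=> _; rewrite leqn0 addn_eq0 => /andP[/eqP-> _].
  move=> h1 h2; case: eqP => // p0; case: eqP => // q0.
  by case: leqP => h; apply: IH; lia.
by move=> h; apply: H.
Qed.

Lemma farey_0l U V x y z q : farey U V x y z 0 q = y.
Proof. by rewrite /farey; case: q. Qed.

Lemma farey_0r U V x y z p : (0 < p)%N -> farey U V x y z p 0 = x.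
Proof. by case: p. Qed.

Lemma farey_right U V x y z p q : (0 < p)%N -> (q <= p)%N ->
  farey U V x y z p q
  = farey U (U + V) x (x * y - L (U + V) - z) y (p - q) q.
Proof.
case: q => [|q] p0 qp; first by rewrite subn0 !farey_0r.
rewrite {1}/farey addnS /= gtn_eqF // qp.
by rewrite farey_rec_fuel //; lia.
Qed.

Lemma farey_left U V x y z p q : (0 < q)%N -> (p <= q)%N ->
  farey U V x y z p q
  = farey (U + V) V (x * y - L (U + V) - z) y x p (q - p).
Proof.
case: p => [|p] q0 pq; first by rewrite subn0 !farey_0l.
(* At p = q the recursion takes the right-hand branch; both branches end at the value at [U + V]. *)
have [qp|pq'] := leqP q p.+1.
  have -> : q = p.+1 by lia.
  by rewrite farey_right // subnn farey_0l farey_0r.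
rewrite {1}/farey addSn /= gtn_eqF // leqNgt pq' /=.
by rewrite farey_rec_fuel //; lia.
Qed.

Lemma farey_11 U V x y z : farey U V x y z 1 1 = x * y - L (U + V) - z.
Proof. by rewrite farey_right // subnn farey_0l. Qed.

(* A side other than {U, V} inside the quadrant spanned by U and V has the form
   {Y, Y + D} with Y, D in the quadrant; the opposite vertices are 2Y + D and D. *)
Lemma farey_edge U V x y z a b c d : nunimod a b c d ->
  farey U V x y z (a + a + c) (b + b + d) + farey U V x y z c d
  = farey U V x y z (a + c) (b + d) * farey U V x y z a b
    - L (comb U V (a + a + c) (b + b + d)).
Proof.
have [n] := ubnP (a + b + c + d).
elim: n U V x y z a b c d => // n IH U V x y z a b c d ltn H.
case: (nunimod_cases H)
  => [[a0 c0 bd0 [ba dc]]|[b0 d0 ac0 [ab cd]]|[-> -> -> ->]|[-> -> -> ->]].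
- rewrite !(@farey_right U V) ?addn_gt0 ?a0 ?leq_add //.
  have -> : (a + a + c - (b + b + d) = (a - b) + (a - b) + (c - d))%N by lia.
  have -> : (a + c - (b + d) = (a - b) + (c - d))%N by lia.
  rewrite IH; first by rewrite -(@comb_right U V (a + a + c)) ?leq_add //;
    congr (_ - L (comb _ _ _ _)); lia.
    by lia.
  by move: H; rewrite /nunimod; nia.
- rewrite !(@farey_left U V) ?addn_gt0 ?b0 ?leq_add //.
  have -> : (b + b + d - (a + a + c) = (b - a) + (b - a) + (d - c))%N by lia.
  have -> : (b + d - (a + c) = (b - a) + (d - c))%N by lia.
  rewrite IH; first by rewrite -(@comb_left U V (a + a + c)) ?leq_add //;
    congr (_ - L (comb _ _ _ _)); lia.
    by lia.
  by move: H; rewrite /nunimod; nia.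
- rewrite !addn0 !add0n (@farey_right U V _ _ _ (1 + 1)) // farey_0l farey_0r //.
  rewrite !farey_11 /comb.
  have -> : (U.1 * (1 + 1)%N%:Z + V.1 * 1%N%:Z, U.2 * (1 + 1)%N%:Z + V.2 * 1%N%:Z)
            = U + (U + V).
    by case: U V {IH} => [u1 u2] [v1 v2]; congr pair => /=; ring.
  by ring.
- rewrite !addn0 !add0n (@farey_left U V _ _ _ 1 (1 + 1)) // farey_0l farey_0r //.
  rewrite !farey_11 /comb.
  have -> : (U.1 * 1%N%:Z + V.1 * (1 + 1)%N%:Z, U.2 * 1%N%:Z + V.2 * (1 + 1)%N%:Z)
            = U + V + V.
    by case: U V {IH} => [u1 u2] [v1 v2]; congr pair => /=; ring.
  by ring.
Qed.

Definition vertex_poly (l1 l2 l3 x y z : R) : R :=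
  x ^+ 2 + y ^+ 2 + z ^+ 2 - x * y * z + (l1 * x + l2 * y + l3 * z).

(** [L v] stands for the parameter of the color of the region of [v]. A region fixes its vector only
    up to sign, and the two regions facing each other across an edge share a color. *)
Hypothesis L_opp : forall v, L (- v) = L v.
Hypothesis L_sub : forall u v, unimod u v -> L (u - v) = L (u + v).

(** Vieta jumping: the vertex polynomial is quadratic in its last argument, and the flip is the
    reflection that preserves this quadratic. *)
Lemma vertex_poly_flip u v x y z : unimod u v ->
  vertex_poly (L u) (L v) (L (u + v)) x y (x * y - L (u + v) - z)
  = vertex_poly (L u) (L v) (L (u - v)) x y z.
Proof. by move=> uv; rewrite L_sub // /vertex_poly; ring. Qed.

(** Each Euclidean step moves the initial triangle to a neighbour by a flip, so the value [mu] is
    carried down to the basis pair. *)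
Lemma farey_vertex mu U V x y z a b c d : nunimod a b c d -> unimod U V ->
  vertex_poly (L U) (L V) (L (U - V)) x y z = mu ->
  vertex_poly (L (comb U V a b)) (L (comb U V c d))
    (L (comb U V (a + c) (b + d)))
    (farey U V x y z a b) (farey U V x y z c d)
    (farey U V x y z (a + c) (b + d)) = mu.
Proof.
have [n] := ubnP (a + b + c + d).
elim: n U V x y z a b c d => // n IH U V x y z a b c d ltn H UV Hmu.
have UVc : comb U V 1 1 = U + V by rewrite -(combD U V 1 0 0 1) comb_10 comb_01.
case: (nunimod_cases H)
  => [[a0 c0 bd0 [ba dc]]|[b0 d0 ac0 [ab cd]]|[-> -> -> ->]|[-> -> -> ->]].
- rewrite !(@farey_right U V) ?addn_gt0 ?a0 ?leq_add //.
  rewrite -!(@comb_right U V) ?leq_add //.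
  have -> : (a + c - (b + d) = (a - b) + (c - d))%N by lia.
  apply: IH; rewrite ?unimodDr //; first by lia.
    by move: H; rewrite /nunimod; nia.
  rewrite -Hmu -(@vertex_poly_flip U V x y z) // opprD addrA subrr sub0r L_opp.
  by rewrite /vertex_poly; ring.
- rewrite !(@farey_left U V) ?addn_gt0 ?b0 ?leq_add //.
  rewrite -!(@comb_left U V) ?leq_add //.
  have -> : (b + d - (a + c) = (b - a) + (d - c))%N by lia.
  apply: IH; rewrite ?unimodDl //; first by lia.
    by move: H; rewrite /nunimod; nia.
  rewrite -Hmu -(@vertex_poly_flip U V x y z) // addrK.
  by rewrite /vertex_poly; ring.
- rewrite !addn0 !add0n comb_10 comb_01 UVc farey_0l farey_0r // farey_11.
  by rewrite vertex_poly_flip.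
- rewrite !addn0 !add0n comb_10 comb_01 UVc farey_0l farey_0r // farey_11.
  by rewrite -Hmu -(@vertex_poly_flip U V x y z) // /vertex_poly; ring.
Qed.

Variable T : R.
Hypothesis T_ge2 : 2 <= T.
Hypothesis L_le : forall v, L v <= T ^+ 2 - 2 * T.

(* Write w = xy - L u - z.  The hypothesis forces xy <= 2w + L u, and since
   (x - 2)(y + w) >= (T - 2)(2T) >= L u + L v, the arrows of the two edges along
   the region with value [x] cannot both point out of the vertex (x, y, w). *)
Lemma arrow_step u v x y z : T <= x -> T <= y -> T <= z ->
  2 * z + L u <= x * y ->
  T <= x * y - L u - z /\ 2 * y + L v <= x * (x * y - L u - z).
Proof.
move=> Tx Ty Tz h; have [w Ew] : {w : R | w = x * y - L u - z} by eexists.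
rewrite -Ew; have Tw : z <= w by rewrite Ew; lra.
split; first exact: le_trans Tz Tw.
have := (T_ge2, L_le u, L_le v) => -[[T2 hu] hv].
have hx : (T - 2) * (T + T) <= (x - 2) * (y + w).
  by apply: ler_pM; lra.
have -> : x * w = x * (y + w) - x * y by ring.
have : x * y <= 2 * w + L u by rewrite Ew; lra.
lra.
Qed.

(** The last hypothesis says that the arrow across the side {U, V} points to the region with value
    [z]. [arrow_step] hands this condition to both sub-quadrants, with [y] or [x] in the role of
    [z]. *)
Lemma farey_ge U V x y z p q : T <= x -> T <= y -> T <= z ->
  2 * z + L (U + V) <= x * y -> T <= farey U V x y z p q.
Proof.
have [n] := ubnP (p + q).
elim: n U V x y z p q => // n IH U V x y z p q ltn Tx Ty Tz h.
have [->|p0] := posnP p; first by rewrite farey_0l.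
have [->|q0] := posnP q; first by rewrite farey_0r.
have [qp|/ltnW pq] := leqP q p.
  have [Tw hw] := arrow_step (U + (U + V)) Tx Ty Tz h.
  by rewrite farey_right //; apply: IH => //; lia.
have [|Tw hw] := @arrow_step (U + V) (U + V + V) y x z Ty Tx Tz.
  by rewrite [y * x]mulrC.
rewrite [y * x]mulrC in Tw hw; rewrite [y * _]mulrC in hw.
by rewrite farey_left //; apply: IH => //; lia.
Qed.

End Farey.

(** * Gluing two quadrants into a map on the plane *)

Section Plane.
Variables (R : realFieldType) (L : int * int -> R).
Hypothesis L_opp : forall v, L (- v) = L v.
Hypothesis L_sub : forall u v, unimod u v -> L (u - v) = L (u + v).

Section Relations.
Variables (mu : R) (Phi : int * int -> R).
Hypothesis Phi_opp : forall v, Phi (- v) = Phi v.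

Definition markoff_at (u v : int * int) : Prop :=
  Phi (u + v) + Phi (u - v) = Phi u * Phi v - L (u + v) /\
  vertex_poly (L u) (L v) (L (u + v)) (Phi u) (Phi v) (Phi (u + v)) = mu.

Lemma markoff_at_sym u v : markoff_at u v -> markoff_at v u.
Proof.
move=> [h1 h2]; split.
  by rewrite -(opprB u v) Phi_opp [v + u]addrC h1; ring.
by rewrite -h2 /vertex_poly [v + u]addrC; ring.
Qed.

(** Changing the sign of [v] exchanges the two endpoints of the edge; the vertex relation passes
    from one to the other by the flip. *)
Lemma markoff_at_oppr u v : unimod u v -> markoff_at u v -> markoff_at u (- v).
Proof.
move=> uv [h1 h2]; split; first by rewrite opprK addrC h1 Phi_opp L_sub.
have -> : Phi (u - v) = Phi u * Phi v - L (u + v) - Phi (u + v).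
  by rewrite -h1; ring.
by rewrite L_opp Phi_opp L_sub // -h2 /vertex_poly; ring.
Qed.

Lemma markoff_at_oppl u v : unimod u v -> markoff_at u v -> markoff_at (- u) v.
Proof.
move=> uv /markoff_at_sym h; apply/markoff_at_sym/markoff_at_oppr => //.
by move: uv; rewrite /unimod distrC.
Qed.

(** By [nunimod_le] a pair other than the basis is {Y + D, Y} with D in the quadrant, and
    [farey_edge] applies. Only the basis pair has an opposite vertex outside, [U - V], which is
    where [z] enters. *)
Lemma markoff_at_quadrant U V z a b c d :
  (forall p q, Phi (comb U V p q) = farey L U V (Phi U) (Phi V) z p q) ->
  Phi (U - V) = z -> unimod U V ->
  vertex_poly (L U) (L V) (L (U - V)) (Phi U) (Phi V) z = mu ->
  nunimod a b c d -> markoff_at (comb U V a b) (comb U V c d).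
Proof.
move=> PhiE Phi_sub UV Hmu H.
have vert a' b' c' d' : nunimod a' b' c' d' ->
    vertex_poly (L (comb U V a' b')) (L (comb U V c' d'))
      (L (comb U V a' b' + comb U V c' d')) (Phi (comb U V a' b'))
      (Phi (comb U V c' d')) (Phi (comb U V a' b' + comb U V c' d')) = mu.
  by move=> H'; rewrite combD !PhiE; apply: farey_vertex.
have base : markoff_at (comb U V 1 0) (comb U V 0 1).
  split; last by apply: vert; left.
  have UV_comb : U + V = comb U V (1 + 0) (0 + 1) by rewrite -combD comb_10 comb_01.
  by rewrite comb_10 comb_01 Phi_sub UV_comb PhiE farey_11 -UV_comb; ring.
have ge a' b' c' d' : nunimod (c' + a') (d' + b') c' d' ->
    markoff_at (comb U V (c' + a') (d' + b')) (comb U V c' d').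
  move=> H'; split; last exact: vert.
  have -> : comb U V (c' + a') (d' + b') - comb U V c' d' = comb U V a' b'.
    by rewrite -combD addrC addKr.
  rewrite combD !PhiE -[(_ + _ + c')%N]addnA -[(_ + _ + d')%N]addnA.
  have -> : (c' + (a' + c') = c' + c' + a')%N by lia.
  have -> : (d' + (b' + d') = d' + d' + b')%N by lia.
  rewrite farey_edge //.
  by move: H'; rewrite /nunimod; nia.
case: (nunimod_le H) => [[ca db]|[ac bd]|[-> -> -> ->]|[-> -> -> ->]] //.
- by rewrite -(subnKC ca) -(subnKC db); apply: ge; rewrite !subnKC.
- apply: markoff_at_sym; rewrite -(subnKC ac) -(subnKC bd).
  by apply: ge; rewrite !subnKC //; case: H; [right|left]; lia.
- exact: markoff_at_sym.
Qed.

End Relations.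

Variables T mu : R.
Hypothesis root_vertex :
  vertex_poly (L (1, 0)) (L (0, 1)) (L (1, 1)) T T T = mu.

(* The value is [T] at the regions oo, 0 and 1; the edge relation across the side
   {oo, 0} then forces the value T * T - L (1, 1) - T at -1. *)
Definition plane_map (v : int * int) : R :=
  if 0 <= v.1 * v.2 then
    farey L (1, 0) (0, 1) T T (T * T - L (1, 1) - T) `|v.1| `|v.2|
  else farey L (-1, 0) (0, 1) T T T `|v.1| `|v.2|.

Lemma plane_mapE a b : plane_map (a, b) =
  if 0 <= a * b then
    farey L (1, 0) (0, 1) T T (T * T - L (1, 1) - T) `|a| `|b|
  else farey L (-1, 0) (0, 1) T T T `|a| `|b|.
Proof. exact: erefl. Qed.

Lemma plane_map_opp v : plane_map (- v) = plane_map v.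
Proof. by case: v => a b; rewrite !plane_mapE mulrNN !abszN. Qed.

Lemma plane_map_pos (p q : nat) : plane_map (p%:Z, q%:Z) =
  farey L (1, 0) (0, 1) T T (T * T - L (1, 1) - T) p q.
Proof.
have pq : 0 <= p%:Z * q%:Z by lia.
by rewrite plane_mapE pq.
Qed.

Lemma plane_map_neg (p q : nat) : plane_map (- p%:Z, q%:Z) =
  farey L (-1, 0) (0, 1) T T T p q.
Proof.
rewrite plane_mapE abszN !absz_nat.
(* On the axes the sign test selects the other formula; both give [T] there. *)
have [->|p0] := posnP p; first by rewrite oppr0 mul0r lexx !farey_0l.
have [->|q0] := posnP q; first by rewrite mulr0 lexx !farey_0r.
have pq : (0 <= - p%:Z * q%:Z) = false by nia.
by rewrite pq.
Qed.

Lemma plane_map_e1 : plane_map (1, 0) = T.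
Proof. by rewrite (plane_map_pos 1 0) farey_0r. Qed.

Lemma plane_map_e2 : plane_map (0, 1) = T.
Proof. by rewrite (plane_map_pos 0 1) farey_0l. Qed.

Lemma plane_map_e12 : plane_map (1, 1) = T.
Proof. by rewrite (plane_map_pos 1 1) farey_11; ring. Qed.

(** Compatibility of the gluing: the value prescribed at -1 as [z] for the first quadrant is the one
    computed in the second. *)
Lemma plane_map_N11 : plane_map (-1, 1) = T * T - L (1, 1) - T.
Proof.
rewrite (plane_map_neg 1 1) farey_11; congr (_ - _ - _).
by rewrite -(@L_sub (0, 1) (1, 0)) //; congr L.
Qed.

Lemma plane_map_markoff u v : unimod u v -> markoff_at mu plane_map u v.
Proof.
have posq (a b c d : nat) : unimod (a%:Z, b%:Z) (c%:Z, d%:Z) ->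
    markoff_at mu plane_map (a%:Z, b%:Z) (c%:Z, d%:Z).
  move=> H.
  have E p q : comb (1, 0) (0, 1) p q = (p%:Z, q%:Z).
    by rewrite /comb /=; congr pair; ring.
  rewrite -(E a b) -(E c d); apply: (@markoff_at_quadrant mu _ plane_map_opp _ _
      (T * T - L (1, 1) - T)) => //.
  - by move=> p q; rewrite E plane_map_pos plane_map_e1 plane_map_e2.
  - by rewrite -plane_map_N11 -plane_map_opp.
  - rewrite plane_map_e1 plane_map_e2 -root_vertex -vertex_poly_flip //.
    by rewrite (_ : (1, 0) + (0, 1) = (1, 1)) // /vertex_poly; ring.
  - by move: H; rewrite /unimod /nunimod /=; nia.
have negq (a b c d : nat) : unimod (- a%:Z, b%:Z) (- c%:Z, d%:Z) ->
    markoff_at mu plane_map (- a%:Z, b%:Z) (- c%:Z, d%:Z).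
  move=> H.
  have E p q : comb (-1, 0) (0, 1) p q = (- p%:Z, q%:Z).
    by rewrite /comb /=; congr pair; ring.
  rewrite -(E a b) -(E c d).
  apply: (@markoff_at_quadrant mu _ plane_map_opp _ _ T) => //.
  - move=> p q; rewrite E plane_map_neg plane_map_e2.
    by rewrite -(plane_map_opp (-1, 0)) plane_map_e1.
  - by rewrite -plane_map_e12 -plane_map_opp.
  - rewrite -(plane_map_opp (-1, 0)) plane_map_e1 plane_map_e2 -root_vertex.
    by rewrite -(L_opp (-1, 0)) -(L_opp (_ - _)).
  - by move: H; rewrite /unimod /nunimod /=; nia.
have oppl x y : unimod x y -> markoff_at mu plane_map (- x) y ->
    markoff_at mu plane_map x y.
  move=> xy h; rewrite -[x]opprK; apply: markoff_at_oppl => //.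
    exact: plane_map_opp.
  by rewrite unimodNl.
have oppr x y : unimod x y -> markoff_at mu plane_map x (- y) ->
    markoff_at mu plane_map x y.
  move=> xy h; apply: markoff_at_sym; first exact: plane_map_opp.
  apply: oppl; first by rewrite unimodC.
  by apply: markoff_at_sym => //; exact: plane_map_opp.
wlog: u / 0 <= u.2.
  move=> W uv; have [h|h] := leP 0 u.2; first exact: W.
  by apply: oppl => //; apply: W; rewrite ?unimodNl //=; lia.
wlog: v / 0 <= v.2.
  move=> W u2 uv; have [h|h] := leP 0 v.2; first exact: W.
  by apply: oppr => //; apply: W;
    rewrite // ?[unimod u _]unimodC ?unimodNl 1?unimodC //=; lia.
have negE (c d : int) : (- c, d) = - (c, - d) by rewrite -[in LHS](opprK d).
have mixed (a b c d : nat) : unimod (a%:Z, b%:Z) (- c%:Z, d%:Z) ->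
    markoff_at mu plane_map (a%:Z, b%:Z) (- c%:Z, d%:Z).
  (* The determinant is a d + c b, a sum of two nonnegative terms equal to 1. One term vanishes, so
     one vector lies on an axis and, up to sign, in the quadrant of the other. *)
  move=> uv; have [/eqP|/eqP] : (a * d = 0 \/ c * b = 0)%N.
  - by move: uv; rewrite /unimod /=; nia.
  - rewrite muln_eq0 => /orP[] /eqP e; rewrite e in uv *.
      by move: uv; rewrite [X in (X, b%:Z)](_ : 0%:Z = - 0%:Z) //; apply: negq.
    move: uv; rewrite negE oppr0 unimodC unimodNl unimodC => uv.
    by apply: markoff_at_oppr => //; [apply: plane_map_opp|apply: posq].
  - rewrite muln_eq0 => /orP[] /eqP e; rewrite e in uv *.
      by move: uv; rewrite oppr0; apply: posq.
    have e' : (a%:Z, 0%:Z) = - (- a%:Z, 0%:Z) by rewrite -[in LHS](opprK a%:Z).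
    move: uv; rewrite e' unimodNl => uv.
    by apply: markoff_at_oppl => //; [apply: plane_map_opp|apply: negq].
case: u v => [a b] [c d] /= d0 b0 uv.
rewrite -(gez0_abs d0) -(gez0_abs b0) in uv *.
have [a0|/ltW a0] := leP 0 a; have [c0|/ltW c0] := leP 0 c.
- by rewrite -(gez0_abs a0) -(gez0_abs c0) in uv *; apply: posq.
- rewrite -oppr_ge0 in c0; rewrite -(opprK c) -(gez0_abs a0) -(gez0_abs c0) in uv *.
  exact: mixed.
- apply: markoff_at_sym; first exact: plane_map_opp.
  rewrite unimodC in uv.
  rewrite -oppr_ge0 in a0; rewrite -(opprK a) -(gez0_abs a0) -(gez0_abs c0) in uv *.
  exact: mixed.
- rewrite -oppr_ge0 in a0; rewrite -oppr_ge0 in c0.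
  rewrite -(opprK a) -(opprK c) -(gez0_abs a0) -(gez0_abs c0) in uv *.
  exact: negq.
Qed.

Hypothesis T_ge2 : 2 <= T.
Hypothesis L_le : forall v, L v <= T ^+ 2 - 2 * T.

Lemma plane_map_ge v : T <= plane_map v.
Proof.
have T2 := T_ge2.
have L2 u : 2 * T + L u <= T * T by have := L_le u; lra.
have aux U V p q : T <= farey L U V T T T p q.
  exact: farey_ge.
rewrite /plane_map; case: ifP => _ //.
have [->|p0] := posnP `|v.1|; first by rewrite farey_0l.
have [->|q0] := posnP `|v.2|; first by rewrite farey_0r.
(* The triangle containing -1 need not satisfy the arrow hypothesis of [farey_ge]. One Euclidean
   step leads to the sub-quadrants at (1, 1), whose three initial values are all [T]. *)
have e : T * T - L ((1, 0) + (0, 1)) - (T * T - L (1, 1) - T) = T.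
  by rewrite (_ : (1, 0) + (0, 1) = (1, 1)) //; ring.
have [qp|/ltnW pq] := leqP `|v.2| `|v.1|.
  by rewrite farey_right // e.
by rewrite farey_left // e.
Qed.

End Plane.

(** * Regions as primitive vectors up to sign *)

Definition region_vec (X : region) : int * int := (rnum X, rden X).

Definition vec_region (v : int * int) : region :=
  if v.2 == 0 then None else Some (v.1%:~R / v.2%:~R).

Lemma region_vecK : cancel region_vec vec_region.
Proof.
case=> [q|] //; rewrite /vec_region /= (negbTE (denq_neq0 q)).
by rewrite divq_num_den.
Qed.

Lemma vec_region_opp v : vec_region (- v) = vec_region v.
Proof.
by rewrite /vec_region /= oppr_eq0 !mulrNz invrN mulrNN.
Qed.

(** The gcd of the entries of [u] divides the determinant, so the fraction is already reduced and
    only the sign of its denominator can change. *)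
Lemma vec_regionK u v : unimod u v ->
  region_vec (vec_region u) = u \/ region_vec (vec_region u) = - u.
Proof.
case: u v => [a b] [c d]; rewrite /unimod /vec_region /= => uv.
have cop : coprime `|a| `|b|.
  have ga : (gcdz a b %| a)%Z := dvdz_gcdl a b.
  have gb : (gcdz a b %| b)%Z := dvdz_gcdr a b.
  have : (gcdz a b %| a * d - c * b)%Z.
    by apply: rpredB; [exact: dvdz_mulr|exact: dvdz_mull].
  rewrite dvdzE /=; have -> : absz (a * d - c * b)%R = 1%N by move: uv; lia.
  by rewrite dvdn1.
have [b0|b0] := eqVneq b 0.
  have : `|a|%N = 1%N by move: cop; rewrite b0 /coprime gcdn0 => /eqP.
  by rewrite b0; case: a {uv cop} => [[|[]]|[]] // _; [left|right].
rewrite /region_vec /= coprimeq_num // coprimeq_den // (negbTE b0).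
have [bp|bn|/eqP] := ltrgt0P b; last by rewrite (negbTE b0).
- by left; rewrite gtr0_sg // mul1r.
- by right; rewrite ltr0_sg // mulN1r.
Qed.

Lemma adjacentE X Y : adjacent X Y = unimod (region_vec X) (region_vec Y).
Proof. by []. Qed.

Lemma adjacent_sym X Y : adjacent X Y = adjacent Y X.
Proof. by rewrite !adjacentE unimodC. Qed.

Lemma adjacent_vec_region u v : unimod u v ->
  adjacent (vec_region u) (vec_region v).
Proof.
move=> uv; have vu : unimod v u by rewrite unimodC.
rewrite adjacentE; case: (vec_regionK uv) => ->; case: (vec_regionK vu) => ->;
  by rewrite ?unimodNl // unimodC unimodNl.
Qed.

Lemma edge_vec_region u v : unimod u v ->
  edge (vec_region u) (vec_region v) (vec_region (u + v)) (vec_region (u - v)).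
Proof.
move=> uv; have uNv : unimod u (- v) by rewrite unimodC unimodNl unimodC.
have vuDv : unimod v (u + v) by rewrite unimodC unimodDl.
have vuBv : unimod v (u - v) by rewrite unimodC -unimodDl subrK.
apply/and3P; split.
- by apply/and3P; split; apply: adjacent_vec_region; rewrite ?unimodDr.
- by apply/and3P; split; apply: adjacent_vec_region; rewrite ?unimodDr.
(* Equality would make u + v and u - v agree up to sign, hence u = 0 or v = 0, against the
   determinant. *)
apply/eqP => /(congr1 region_vec).
have K1 := vec_regionK (etrans (unimodC _ _) vuDv).
have K2 := vec_regionK (etrans (unimodC _ _) vuBv).
move: uv K1 K2; case: u v {uNv vuDv vuBv} => [a b] [c d]; rewrite /unimod /=.
move=> uv [->|->] [->|->] [] e1 e2.
- have [c0 d0] : c = 0 /\ d = 0 by lia.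
  by move: uv; rewrite c0 d0; lia.
- have [c0 d0] : a = 0 /\ b = 0 by lia.
  by move: uv; rewrite c0 d0; lia.
- have [c0 d0] : a = 0 /\ b = 0 by lia.
  by move: uv; rewrite c0 d0; lia.
- have [c0 d0] : c = 0 /\ d = 0 by lia.
  by move: uv; rewrite c0 d0; lia.
Qed.

Lemma vertex_third X Y Z : vertex X Y Z ->
  Z = vec_region (region_vec X + region_vec Y) \/
  Z = vec_region (region_vec X - region_vec Y).
Proof.
rewrite /vertex !adjacentE => h; rewrite -(region_vecK Z); move: h.
case: (region_vec X) (region_vec Y) (region_vec Z) => [a b] [c d] [e f].
rewrite /unimod /= => /and3P[].
move=> hD ht hs.
have sign (x : int) : `|x| == 1 -> x = 1 \/ x = -1 by lia.
have [D [eD hD']] : exists D, a * d - c * b = D /\ (D = 1 \/ D = -1).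
  by exists (a * d - c * b); split=> //; exact: sign.
have DD : D * D = 1 by case: hD' => ->.
have unit_sign (x : int) : `|x| == 1 -> D * x = 1 \/ D * x = -1.
  by case: hD' => -> /sign[] ->; [left|right|right|left].
have [s [es hs']] : exists s, a * f - e * b = s /\ (D * s = 1 \/ D * s = -1).
  by exists (a * f - e * b); split=> //; apply: unit_sign.
have [t [et ht']] : exists t, c * f - e * d = t /\ (D * t = 1 \/ D * t = -1).
  by exists (c * f - e * d); split=> //; apply: unit_sign.
(* Cramer's rule in the basis of the first two vectors; [D] is its own inverse, and both
   coefficients are 1 or -1. *)
have -> : e = D * s * c - D * t * a by rewrite -[LHS]mul1r -DD -{2}eD -es -et; ring.
have -> : f = D * s * d - D * t * b by rewrite -[LHS]mul1r -DD -{2}eD -es -et; ring.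
case: hs' ht' => -> [] ->; rewrite ?mul1r ?mulN1r ?opprK.
- by right; rewrite -vec_region_opp; congr (vec_region (_, _)) => /=; ring.
- by left; congr (vec_region (_, _)) => /=; ring.
- by left; rewrite -vec_region_opp; congr (vec_region (_, _)) => /=; ring.
- by right; congr (vec_region (_, _)) => /=; ring.
Qed.

(** This turns sums and products over colors into ones over the regions at a vertex, in any
    order. *)
Lemma big_ord3_distinct (S : Type) (idx : S) (op : Monoid.com_law idx)
    (f : 'I_3 -> S) (i j k : 'I_3) : i != j -> j != k -> i != k ->
  \big[op/idx]_l f l = op (f i) (op (f j) (f k)).
Proof.
move=> ij jk ik; rewrite (bigD1 i) // (bigD1 j) 1?eq_sym //=.
rewrite (bigD1 k) /=; last by rewrite eq_sym ik eq_sym jk.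
rewrite big_pred0 ?Monoid.mulm1 // => l.
move: ij jk ik (ltn_ord i) (ltn_ord j) (ltn_ord k) (ltn_ord l).
by rewrite -!val_eqE /=; lia.
Qed.

(** * The cubic and the upper bound at a sink *)

Section Cubic.
Variable R : realFieldType.
Implicit Types T S mu x l : R.

Lemma cubic_gt0 T S mu x : 2 <= T -> mu <= 4 ->
  T ^+ 3 - 3 * T ^+ 2 - S * T + mu = 0 -> T < x ->
  0 < x ^+ 3 - 3 * x ^+ 2 - S * x + mu.
Proof.
move=> T2 mu4 root_T Tx.
(* Eliminating [S] between f(x) and f(T) = 0 leaves a multiple of x - T. Its cofactor is positive
   because T x > 4, x + T - 3 > 1 and mu <= 4. *)
have eq1 : T * (x ^+ 3 - 3 * x ^+ 2 - S * x + mu)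
  = (x - T) * (T * x * (x + T - 3) - mu)
    + x * (T ^+ 3 - 3 * T ^+ 2 - S * T + mu) by ring.
have pos : 0 < T * (x ^+ 3 - 3 * x ^+ 2 - S * x + mu).
  rewrite eq1 root_T mulr0 addr0; apply: mulr_gt0; first by lra.
  have : 2 * 2 < T * x by nra.
  nra.
by move: pos; rewrite pmulr_rgt0 //; lra.
Qed.

Lemma cubic_root_le T S mu l : 2 <= T -> mu <= 4 ->
  T ^+ 3 - 3 * T ^+ 2 - S * T + mu = 0 -> l <= S -> l <= T ^+ 2 - 2 * T.
Proof.
move=> T2 mu4 root_T lS.
(* By the root equation this product equals T^2 - mu, and T^2 >= 4 >= mu. *)
have : 0 <= T * (T ^+ 2 - 2 * T - S) by nra.
by rewrite pmulr_rge0 ?subr_ge0; [exact: le_trans|lra].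
Qed.

Lemma sorted_sink_min_le T mu l1 l2 l3 x y z : 2 <= T -> mu <= 4 ->
  0 <= l1 -> 0 <= l2 -> 0 <= l3 ->
  T ^+ 3 - 3 * T ^+ 2 - (l1 + l2 + l3) * T + mu = 0 ->
  vertex_poly l1 l2 l3 x y z = mu -> 2 * z + l3 <= x * y ->
  x <= y -> y <= z -> x <= T.
Proof.
move=> T2 mu4 l1p l2p l3p root_T Hmu zsink xy yz; rewrite leNgt; apply/negP => Tx.
have fx := cubic_gt0 T2 mu4 root_T Tx.
have h2 : l2 <= T ^+ 2 - 2 * T by apply: cubic_root_le root_T _ => //; lra.
have h3 : l3 <= T ^+ 2 - 2 * T by apply: cubic_root_le root_T _ => //; lra.
(* With F the vertex polynomial, [d1] is F(x, y, y) - F(x, y, z) and [d2] is F(x, x, x) - F(x, y,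
   y), each factored. *)
have d1 : 0 <= (z - y) * (x * y - (y + z + l3)) by apply: mulr_ge0; lra.
have d2 : 0 <= (y - x) * ((x - 2) * (x + y) - (l2 + l3)).
  apply: mulr_ge0; first by lra.
  have : (T - 2) * (T + T) <= (x - 2) * (x + y) by apply: ler_pM; lra.
  lra.
by move: fx Hmu d1 d2; rewrite /vertex_poly; lra.
Qed.

(** The hypotheses are invariant under permuting values and parameters together, so the values may
    be sorted. *)
Lemma sink_min_le T mu l1 l2 l3 x y z : 2 <= T -> mu <= 4 ->
  0 <= l1 -> 0 <= l2 -> 0 <= l3 ->
  T ^+ 3 - 3 * T ^+ 2 - (l1 + l2 + l3) * T + mu = 0 ->
  vertex_poly l1 l2 l3 x y z = mu ->
  2 * x + l1 <= y * z -> 2 * y + l2 <= x * z -> 2 * z + l3 <= x * y ->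
  Num.min x (Num.min y z) <= T.
Proof.
move=> T2 mu4 p1 p2 p3 root_T Hmu xs ys zs; rewrite !ge_min.
have xs' : 2 * x + l1 <= z * y by rewrite [z * y]mulrC.
have ys' : 2 * y + l2 <= z * x by rewrite [z * x]mulrC.
have zs' : 2 * z + l3 <= y * x by rewrite [y * x]mulrC.
have [xy|/ltW xy] := leP x y; have [yz|/ltW yz] := leP y z;
  have [xz|/ltW xz] := leP x z.
- by rewrite (@sorted_sink_min_le T mu l1 l2 l3 x y z).
- by rewrite (@sorted_sink_min_le T mu l1 l2 l3 x y z).
- rewrite (@sorted_sink_min_le T mu l1 l3 l2 x z y) //; move: root_T Hmu.
    by move=> <- _; ring.
  by move=> _ <-; rewrite /vertex_poly; ring.
- rewrite (@sorted_sink_min_le T mu l3 l1 l2 z x y) ?orbT //;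
    move: root_T Hmu.
    by move=> <- _; ring.
  by move=> _ <-; rewrite /vertex_poly; ring.
- rewrite (@sorted_sink_min_le T mu l2 l1 l3 y x z) ?orbT //;
    move: root_T Hmu.
    by move=> <- _; ring.
  by move=> _ <-; rewrite /vertex_poly; ring.
- rewrite (@sorted_sink_min_le T mu l2 l3 l1 y z x) ?orbT //; move: root_T Hmu.
    by move=> <- _; ring.
  by move=> _ <-; rewrite /vertex_poly; ring.
- rewrite (@sorted_sink_min_le T mu l3 l2 l1 z y x) ?orbT //;
    move: root_T Hmu.
    by move=> <- _; ring.
  by move=> _ <-; rewrite /vertex_poly; ring.
- rewrite (@sorted_sink_min_le T mu l3 l2 l1 z y x) ?orbT //;
    move: root_T Hmu.
    by move=> <- _; ring.
  by move=> _ <-; rewrite /vertex_poly; ring.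
Qed.

End Cubic.

Lemma cubic_root_exists (R : rcfType) (S mu : R) : 0 <= S -> mu <= 4 ->
  exists2 T : R, 2 <= T & T ^+ 3 - 3 * T ^+ 2 - S * T + mu = 0.
Proof.
move=> S0 mu4; pose p := 'X^3 - 3 *: 'X^2 - S *: 'X + mu%:P.
have pE x : p.[x] = x ^+ 3 - 3 * x ^+ 2 - S * x + mu.
  by rewrite /p !hornerE.
(* Chosen so that B - S - 4 and B + mu are nonnegative, which makes f(B) a sum of nonnegative
   terms. *)
pose B := 4 + S + `|mu|.
have B4 : 4 <= B by rewrite /B; have := normr_ge0 mu; lra.
have [||T /andP[T2 _] /rootP rT] := @poly_ivt _ p 2 B.
- by lra.
- rewrite !pE; apply/andP; split; first by lra.
  have Bmu : 0 <= B + mu by rewrite /B; have := ler_norm (- mu); rewrite normrN; lra.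
  have BS : 0 <= B - S - 4 by rewrite /B; have := normr_ge0 mu; lra.
  have -> : B ^+ 3 - 3 * B ^+ 2 - S * B + mu
    = B * (B * (B - S - 4) + S * (B - 1) + (B - 1)) + (B + mu) by ring.
  have h1 : 0 <= B * (B - S - 4) by apply: mulr_ge0; lra.
  have h2 : 0 <= S * (B - 1) by apply: mulr_ge0; lra.
  by rewrite addr_ge0 //; apply: mulr_ge0; lra.
by exists T => //; rewrite -pE.
Qed.

(** * Transfer to colored regions, and the sink constant *)

Section Coloring.
Variables (c : region -> 'I_3) (ce : region -> region -> 'I_3).
Hypothesis hc : tricoloring c ce.

Lemma color_sub u v : unimod u v ->
  c (vec_region (u - v)) = c (vec_region (u + v)).
Proof. by move=> uv; have [<- <- _] := hc (edge_vec_region uv). Qed.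

Lemma adjacent_color X Y : adjacent X Y -> c X != c Y.
Proof.
rewrite adjacentE => /edge_vec_region/hc[_ _ [_ _]].
by rewrite !region_vecK => /eqP.
Qed.

Lemma vertex_sum_colors (S : Type) (idx : S) (op : Monoid.com_law idx)
    (f : 'I_3 -> S) X Y Z : vertex X Y Z ->
  \big[op/idx]_l f l = op (f (c X)) (op (f (c Y)) (f (c Z))).
Proof.
by case/and3P => XY YZ XZ; apply: big_ord3_distinct; apply: adjacent_color.
Qed.

Variable R : realType.
Variables (lam : 'I_3 -> R) (mu : R).

(** The definition lists the regions at a vertex by color; since the relation is symmetric under
    permuting regions with their parameters, any order will do. *)
Lemma real_markoff_mapP (psi : region -> R[i]) (phi : region -> R) :
  (forall X, psi X = (phi X)%:C) ->
  markoff_map c ce (fun i => (lam i)%:C) mu%:C psi <->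
  (forall X Y Z, vertex X Y Z ->
    vertex_poly (lam (c X)) (lam (c Y)) (lam (c Z)) (phi X) (phi Y) (phi Z)
    = mu) /\
  (forall X Y Z W, edge X Y Z W ->
    phi Z + phi W = phi X * phi Y - lam (ce X Y)).
Proof.
move=> psiE; have sumE (X : 'I_3 -> region) : (forall i, c (X i) = i) ->
    vertex (X 0) (X 1) (X 2) ->
    \sum_i psi (X i) ^+ 2 - \prod_i psi (X i) + \sum_i (lam i)%:C * psi (X i)
    = (vertex_poly (lam (c (X 0))) (lam (c (X 1))) (lam (c (X 2)))
        (phi (X 0)) (phi (X 1)) (phi (X 2)))%:C.
  move=> cX vX; rewrite !(vertex_sum_colors _ _ vX) !cX !psiE /vertex_poly.
  by rewrite !(rmorphD, rmorphB, rmorphM, rmorphXn) /=; ring.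
split=> [[Hv He]|[Hv He]]; split.
- move=> X Y Z vXYZ; have /and3P[XY YZ XZ] := vXYZ.
  have [cXY cYZ cXZ] := And3 (adjacent_color XY) (adjacent_color YZ)
    (adjacent_color XZ).
  (* [V] lists the three regions by color, the form that the definition requires. *)
  pose V i := if c X == i then X else if c Y == i then Y else Z.
  have VX : V (c X) = X by rewrite /V eqxx.
  have VY : V (c Y) = Y by rewrite /V (negbTE cXY) eqxx.
  have VZ : V (c Z) = Z by rewrite /V (negbTE cXZ) (negbTE cYZ).
  have cV i : c (V i) = i.
    rewrite /V; case: eqVneq => // iX; case: eqVneq => // iY.
    apply/val_inj; move: cXY cYZ cXZ iX iY; rewrite -!val_eqE /=.
    move: (ltn_ord i) (ltn_ord (c X)) (ltn_ord (c Y)) (ltn_ord (c Z)).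
    by lia.
  have adjV i j : i != j -> adjacent (V i) (V j).
    rewrite -[i in i != _]cV -[j in _ != j]cV /V.
    by do ?case: ifP => _; rewrite ?eqxx // adjacent_sym.
  apply: (@complexI R); rewrite -(Hv V) //; last by rewrite /vertex !adjV.
  by rewrite !(vertex_sum_colors _ _ vXYZ) VX VY VZ !psiE /vertex_poly
    !(rmorphD, rmorphB, rmorphM, rmorphXn) /=; ring.
- move=> X Y Z W /He; rewrite !psiE => e; apply: complexI.
  by rewrite rmorphD rmorphB rmorphM.
- by move=> X cX vX; rewrite sumE // Hv.
- by move=> X Y Z W /He e; rewrite !psiE -rmorphD e rmorphB rmorphM.
Qed.

Lemma sink_markoff_map T : 2 <= T -> (forall i, lam i <= T ^+ 2 - 2 * T) ->
  vertex_poly (lam (c None)) (lam (c (Some 0))) (lam (c (Some 1))) T T T = mu ->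
  exists phi : region -> R,
    [/\ markoff_map c ce (fun i => (lam i)%:C) mu%:C (fun X => (phi X)%:C),
        forall X, T <= phi X
      & [/\ phi None = T, phi (Some 0) = T & phi (Some 1) = T]].
Proof.
move=> T2 lam_le root_T; pose L v := lam (c (vec_region v)).
have L_opp v : L (- v) = L v by rewrite /L vec_region_opp.
have L_sub u v : unimod u v -> L (u - v) = L (u + v).
  by move=> uv; rewrite /L color_sub.
have L_le v : L v <= T ^+ 2 - 2 * T by apply: lam_le.
have e0 : vec_region (0, 1) = Some 0 by exact: (region_vecK (Some 0)).
have e1 : vec_region (1, 1) = Some 1 by exact: (region_vecK (Some 1)).
have root_L : vertex_poly (L (1, 0)) (L (0, 1)) (L (1, 1)) T T T = mu.
  by rewrite /L e0 e1.
pose f := plane_map L T.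
have f_opp v : f (- v) = f v by apply: plane_map_opp.
have f_reg u v : unimod u v -> f (region_vec (vec_region u)) = f u.
  by case/vec_regionK => ->.
have f_markoff := plane_map_markoff L_opp L_sub root_L.
have LE X : L (region_vec X) = lam (c X) by rewrite /L region_vecK.
exists (fun X => f (region_vec X)); split.
- apply/(real_markoff_mapP (fun X => erefl (f (region_vec X))%:C)).
  split=> [X Y Z vXYZ|X Y Z W /and3P[vZ vW ZW]].
    have /and3P[XY _ _] := vXYZ; rewrite adjacentE in XY.
    (* The third region comes from u + v or from u - v; the second case is the first for the pair u,
       -v. *)
    rewrite -!LE; case: (vertex_third vXYZ) => ->.
      have [_ <-] := f_markoff _ _ XY.
      by rewrite (@f_reg _ (region_vec Y)) ?unimodDl // {3}/L region_vecK.
    have XNY : unimod (region_vec X) (- region_vec Y).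
      by rewrite unimodC unimodNl unimodC.
    have [_ <-] := f_markoff _ _ XNY.
    rewrite (@f_reg _ (- region_vec Y)) ?unimodDl // {3}/L region_vecK.
    by rewrite L_opp [plane_map _ _ (- _)]f_opp.
  have /and3P[XY _ _] := vZ; rewrite adjacentE in XY.
  have XNY : unimod (region_vec X) (- region_vec Y).
    by rewrite unimodC unimodNl unimodC.
  have [rel _] := f_markoff _ _ XY.
  have [ceZ ceW _] := hc (introT and3P (And3 vZ vW ZW)).
  have fp := @f_reg (region_vec X + region_vec Y) (region_vec Y).
  have fm := @f_reg (region_vec X - region_vec Y) (- region_vec Y).
  rewrite unimodDl in fp; rewrite unimodDl in fm.
  (* As [Z] and [W] differ, they are the regions of u + v and u - v in some order, and the relation
     at (u, v) is the edge relation. *)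
  case: (vertex_third vZ) (vertex_third vW) => eZ [] eW.
  + by rewrite eZ eW eqxx in ZW.
  + by rewrite eZ eW fp // fm // -/f in rel *; rewrite rel ceZ eZ.
  + by rewrite eZ eW fp // fm // addrC rel ceW eW.
  + by rewrite eZ eW eqxx in ZW.
- by move=> X; apply: plane_map_ge.
- by split; [exact: plane_map_e1|exact: plane_map_e2|exact: plane_map_e12].
Qed.

End Coloring.

Theorem theorem3 (R : realType)
    (c : region -> 'I_3) (ce : region -> region -> 'I_3)
    (hc : tricoloring c ce)
    (lam : 'I_3 -> R) (mu : R)
    (hlam : forall i, 0 <= lam i) (hmu : mu <= 4) :
  exists T : R,
    is_largest_positive_root
      ('X^3 - 3 *: 'X^2 - (\sum_i lam i) *: 'X + mu%:P) T /\
    is_sink_constant c ce (fun i => (lam i)%:C) mu%:C T.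
Proof.
have lam_sum i : lam i <= \sum_j lam j.
  by rewrite (bigD1 i) //= lerDl sumr_ge0.
have S0 : 0 <= \sum_i lam i by apply: sumr_ge0.
have [T T2 root_T] := cubic_root_exists S0 hmu.
have rootE x : root ('X^3 - 3 *: 'X^2 - (\sum_i lam i) *: 'X + mu%:P) x
    = (x ^+ 3 - 3 * x ^+ 2 - (\sum_i lam i) * x + mu == 0).
  by rewrite /root !hornerE.
exists T; split.
  split; [lra|by rewrite rootE root_T|move=> x _; rewrite rootE => /eqP root_x].
  rewrite leNgt; apply/negP => /(cubic_gt0 T2 hmu root_T).
  by rewrite root_x ltxx.
split=> [phi Hphi phi_pos X Y Z [vXYZ [W1 /andP[e1 a1]] [W2 /andP[e2 a2]]
    [W3 /andP[e3 a3]]]|m Hm].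
  pose r U := complex.Re (phi U).
  have phiE U : phi U = (r U)%:C.
    by rewrite /r RRe_real // gtr0_real.
  have r_pos U : 0 < r U by rewrite -ltcR -phiE.
  have [Hv He] := (real_markoff_mapP hc lam mu phiE).1 Hphi.
  (* Substituting the edge relation for the value at [W] turns the arrow into the inequality of
     [sink_min_le]. *)
  have sinkE U V W U' : edge U V W U' -> `|phi U'| <= `|phi W| ->
      2 * r U' + lam (c U') <= r U * r V.
    move=> e; rewrite !gtr0_norm // !phiE lecR.
    by have := He _ _ _ _ e; have [_ <- _] := hc _ _ _ _ e; lra.
  rewrite !gtr0_norm // !phiE.
  have minC (x y : R) : Num.min x%:C y%:C = (Num.min x y)%:C.
    by rewrite !minEle lecR; case: ifP.
  rewrite !minC lecR; apply: sink_min_le (Hv _ _ _ vXYZ) _ _ _ => //.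
  - by move: root_T; rewrite (vertex_sum_colors hc _ _ vXYZ) /= addrA.
  - exact: sinkE e1 a1.
  - exact: sinkE e2 a2.
  - exact: sinkE e3 a3.
have lam_le i : lam i <= T ^+ 2 - 2 * T by exact: cubic_root_le root_T _.
have v01 : vertex None (Some 0) (Some 1) by [].
have [||phi [Hphi phi_ge [phi_oo phi0 phi1]]] :=
  @sink_markoff_map c ce hc R lam mu T T2.
- by [].
- by move: root_T; rewrite (vertex_sum_colors hc _ _ v01) /= /vertex_poly; lra.
have phi_pos X : 0 < phi X by have := phi_ge X; lra.
have norm_phi X : `|(phi X)%:C| = (phi X)%:C by rewrite gtr0_norm // ltcR.
have arrow_to X Y Z W : edge X Y Z W -> phi W = T ->
    arrow (fun U => (phi U)%:C) X Y Z W.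
  by move=> e phiW; rewrite /arrow e !norm_phi lecR phiW phi_ge.
have := Hm _ Hphi _ None (Some 0) (Some 1).
rewrite !norm_phi phi_oo phi0 phi1 !minxx lecR; apply.
  by move=> X; rewrite ltcR.
split=> //.
(* Across the sides {0, 1}, {oo, 1} and {oo, 0} of the initial triangle lie 1/2, 2 and -1. *)
- by exists (Some 2^-1); apply: arrow_to.
- by exists (Some 2); apply: arrow_to.
- by exists (Some (-1)); apply: arrow_to.
Qed.
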